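(* Let $G_1$ and $G_2$ be degree-similar graphs. If $G_1$ is a unicyclic graph, then $G_1$ is isomorphic to $G_2$.
   Context: All graphs are finite and simple, and all matrices are over the complex field $\mathbb{C}$. For a graph $G$, $A(G)$ denotes its adjacency matrix and $D(G)$ its degree matrix (the diagonal matrix of vertex degrees). Two graphs $G_1$ and $G_2$ are called degree-similar if there exists an invertible matrix $M$ such that $A(G_1)M=MA(G_2)$ and $D(G_1)M=MD(G_2)$ (in particular, they have the same number of vertices). A graph is called unicyclic if it is connected and contains exactly one cycle. *)

(* Defs.v *)
From HB Require Import structures.
From mathcomp Require Import all_boot all_order all_algebra.
From mathcomp Require Import reals complex.
Set Implicit Arguments.
Unset Strict Implicit.
Unset Printing Implicit Defensive.
Import GRing.Theory.
Local Open Scope ring_scope.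

Record sgraph := SGraph {
  vertex :> finType;
  edge : rel vertex;
  edge_sym : symmetric edge;
  edge_irrefl : irreflexive edge }.

Definition deg (G : sgraph) (x : G) : nat := #|[set y | edge x y]|.

(* Rows and columns are indexed by 'I_#|G| through the enumeration
   enum_val : 'I_#|G| -> G of the vertices. *)
Definition adj_mx (F : pzSemiRingType) (G : sgraph) : 'M[F]_#|G| :=
  \matrix_(i, j) (edge (enum_val i) (enum_val j))%:R.

Definition deg_mx (F : pzSemiRingType) (G : sgraph) : 'M[F]_#|G| :=
  diag_mx (\row_i (deg (enum_val i))%:R).

(* The two vertex sets need not be the same type, so M has the rectangular type
   'M_(m, n), to which unitmx does not apply.  Over a field a two-sided inverse
   forces m = n. *)
Definition invertible_mx (F : pzSemiRingType) m n (M : 'M[F]_(m, n)) : Prop :=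
  exists N : 'M[F]_(n, m), M *m N = 1%:M /\ N *m M = 1%:M.

Definition degree_similar (R : realType) (G1 G2 : sgraph) : Prop :=
  exists M : 'M[R[i]]_(#|G1|, #|G2|),
    [/\ invertible_mx M,
        adj_mx _ G1 *m M = M *m adj_mx _ G2
      & deg_mx _ G1 *m M = M *m deg_mx _ G2].

Definition connected_graph (G : sgraph) : Prop :=
  forall x y : G, connect (@edge G) x y.

Definition cycle_edges (G : sgraph) (c : seq G) : {set {set G}} :=
  [set [set x; next c x] | x in c].

(* A cycle is a subgraph; it is identified with its edge set, so that the
   rotations and reversals of one cyclic sequence count as a single cycle.
   The bound on the size excludes the degenerate sequences [::] and [:: x; y],
   which ucycle accepts. *)
Definition is_cycle (G : sgraph) (C : {set {set G}}) : Prop :=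
  exists c : seq G,
    [/\ (3 <= size c)%N, ucycle (@edge G) c & C = cycle_edges c].

Definition unicyclic (G : sgraph) : Prop :=
  connected_graph G /\ exists! C : {set {set G}}, is_cycle C.

Definition isomorphic (G1 G2 : sgraph) : Prop :=
  exists f : G1 -> G2,
    bijective f /\ forall x y : G1, edge (f x) (f y) = edge x y.

(* Main.v *)
Require Import Defs.
From mathcomp Require Import all_boot all_order all_algebra.
From mathcomp Require Import reals complex.
From mathcomp Require Import zify ring.

(** Let M be an invertible matrix that intertwines the adjacency and the degree
    matrices.  A pair of vertex functions f1, f2 is called compatible with M when
    M x y <> 0 forces f1 x = f2 y; equivalently, M intertwines the diagonal
    matrices of f1 and f2.  Degrees are compatible by hypothesis.  Comparing
    traces shows that compatible functions have equal sums ([compat_sum]), so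
    that compatible sets have the same size.  Since M also intertwines the
    Laplacians, whose kernels consist of the locally constant vectors,
    connectedness passes from G1 to G2 ([conn_transfer]), and all row sums and
    column sums of M equal one nonzero constant ([row_sumE], [col_sumE]).

    Trees are pruned off.  A connected graph with a single cycle is a connected
    graph with as many edges as vertices, and the latter property survives the
    deletion of all leaves.  If E is the diagonal indicator of the leaves of a
    given colour, then A E A restricted to the other vertices is diagonal,
    because a leaf has only one neighbour; its entries count the leaves of that
    colour hanging at a vertex.  So the multiset of leaf colours is compatible
    ([compat_leaf_count]), and it can be recorded in a new colour of the pruned
    graph.  Conversely a colour preserving isomorphism of the pruned graphs
    extends to the leaves, since corresponding vertices carry the same multiset
    of leaf colours ([iso_extend]).

    There remain two coloured cycles.  Constancy of the row and column sums
    of M implies that for every word of colours the two cycles have the same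
    number of walks that spell it ([compat_walks]).  Unrolling a cycle, a walk is
    a starting arc together with a sequence of forward and backward steps.  A
    walk of k steps that turns back somewhere stays in a window of k
    consecutive vertices, so the number of such walks is determined by the
    multiset of the colour words of windows of length k; hence, by induction on
    k, the number of walks that never turn back, that is, the multiset of windows
    of length k + 1, is also the same for both cycles ([perm_windows]).  For
    windows as long as the cycle this says that the two coloured cycles are
    isomorphic ([cycle_iso]). *)

Set Implicit Arguments.
Unset Strict Implicit.
Unset Printing Implicit Defensive.
Import GRing.Theory Num.Theory.

(** * Colour words of walks on an unrolled cycle *)

(** In the application T is the set of arcs of a cycle, f and g rotate arcs
    forward and backward, and the booleans of s say which way each step of a
    walk goes. *)
Section Lines.
Variables (C : eqType) (T : finType) (f g : T -> T) (c : T -> C).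

Fixpoint walk_colors (s : seq bool) (e : T) : seq C :=
  c e :: if s is b :: s' then walk_colors s' (if b then f e else g e) else [::].

Definition window m e := [seq c (iter j f e) | j <- iota 0 m].

Lemma windowS m e : window m.+1 e = c e :: window m (f e).
Proof.
rewrite /window /= -[1]addn0 iotaDl -map_comp; congr cons.
by apply: eq_map => j /=; rewrite -iterSr.
Qed.

Lemma walk_colors_straight k e : walk_colors (nseq k true) e = window k.+1 e.
Proof. by elim: k e => [|k IH] e //; rewrite windowS /= IH. Qed.

End Lines.

(** Steps are taken on the positions 0, ..., m - 1 of a window, starting at a. *)
Fixpoint stays_in m a (s : seq bool) : bool :=
  (a < m) && if s is b :: s' then
    if b then stays_in m a.+1 s' else (0 < a) && stays_in m a.-1 s'
  else true.

Fixpoint read_along (C : Type) (x0 : C) (z : seq C) a (s : seq bool) : seq C :=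
  nth x0 z a ::
    if s is b :: s' then read_along x0 z (if b then a.+1 else a.-1) s'
    else [::].

Lemma stays_in_shift m a s : stays_in m a s -> stays_in m.+1 a.+1 s.
Proof.
elim: s a => [|b s IH] a /=; first by rewrite ltnS.
case: b => /andP[am h]; rewrite ltnS am /=; first exact: IH.
by case/andP: h => a0 /IH; case: a a0 {am}.
Qed.

Lemma stays_in_widen m a s : stays_in m a s -> stays_in m.+1 a s.
Proof.
elim: s a => [|b s IH] a /=; first by rewrite !andbT; apply: ltnW.
case: b => /andP[am h]; rewrite (ltnW am : a < m.+1) /=; first exact: IH.
by case/andP: h => -> /IH.
Qed.

Lemma stays_in_lt m a s : stays_in m a s -> a < m.
Proof. by case: s => [|b s] /= /andP[]. Qed.

(** The walk can be prolonged at its beginning by a forward step that starts one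
    position to the left; if there is no room there, the window is shifted. *)
Lemma stays_in_up m a s : stays_in m a s ->
  exists a', stays_in m.+1 a' (true :: s).
Proof.
case: a => [|a] h.
  by exists 0; rewrite /= stays_in_shift.
by exists a; rewrite /= (leqW (ltnW (stays_in_lt h))) stays_in_widen.
Qed.

Lemma stays_in_exists s : exists a, stays_in (size s).+1 a s.
Proof.
elim: s => [|[] s [a h]] /=; first by exists 0.
- by have [a' h'] := stays_in_up h; exists a'.
- exists a.+1; rewrite /= ltnS (stays_in_lt h) /=; exact: stays_in_widen.
Qed.

(** A walk with size s + 1 steps visits at most size s + 2 positions, and each
    change of direction costs at least one of them.  Only walks that begin with a
    forward step matter: the first step of a walk on a cycle can be used to
    orient the cycle. *)
Lemma bent_stays_in s : s != nseq (size s) true ->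
  exists a, stays_in (size s).+1 a (true :: s).
Proof.
elim: s => [|[] s IH] //=.
  rewrite eqseq_cons /= => /IH [a h].
  by have [a' h'] := stays_in_up h; exists a'.
move=> _; have [a h] := stays_in_exists s; exists a.
have am := stays_in_lt h.
by rewrite /= (ltnW am : a < _.+1) ltnS am /=; apply: stays_in_widen.
Qed.

(** All colours met by a walk inside a window are a function of the colour word
    of that window, so counting windows suffices to count these walks. *)
Lemma walk_colors_read (C : eqType) (T : finType) (f g : T -> T) (c : T -> C)
    (x0 : C) m a s e : cancel f g -> stays_in m a s ->
  walk_colors f g c s (iter a f e) = read_along x0 (window f c m e) a s.
Proof.
move=> fK; elim: s a => [|b s IH] a /= /andP[am h].
  by rewrite (nth_map 0) ?size_iota // nth_iota.
rewrite (nth_map 0) ?size_iota // nth_iota //; congr cons.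
case: b h => h; first by rewrite -IH.
case/andP: h; case: a am => // a am _ h; by rewrite /= fK -IH.
Qed.

Fixpoint signs k : seq (seq bool) :=
  if k is k'.+1 then map (cons true) (signs k') ++ map (cons false) (signs k')
  else [:: [::]].

Lemma mem_signs k s : (s \in signs k) = (size s == k).
Proof.
elim: k s => [|k IH] s; first by rewrite inE -size_eq0.
rewrite /= mem_cat; case: s => [|b s].
  by apply/orP => -[] /mapP[].
rewrite /= eqSS -IH; apply/orP/idP.
  by case=> /mapP[s' h [_ ->]].
by case: b => h; [left|right]; apply: map_f.
Qed.

Lemma signs_uniq k : uniq (signs k).
Proof.
elim: k => //= k IH; rewrite cat_uniq !map_inj_uniq ?IH; try by move=> ? ? [].
by rewrite andbT /=; apply/hasPn => s /mapP[s' _ ->]; apply/mapP => -[].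
Qed.

Section TwoLines.
Variables (C : eqType) (x0 : C).
Variables (T1 T2 : finType) (f1 g1 : T1 -> T1) (f2 g2 : T2 -> T2).
Variables (c1 : T1 -> C) (c2 : T2 -> C).
Hypotheses (f1K : cancel f1 g1) (g1K : cancel g1 f1).
Hypotheses (f2K : cancel f2 g2) (g2K : cancel g2 f2).

Lemma perm_enum_can (T : finType) (f g : T -> T) : cancel f g -> cancel g f ->
  forall a, perm_eq [seq iter a f e | e <- enum T] (enum T).
Proof.
move=> fK gK a; apply: uniq_perm; rewrite ?enum_uniq //.
  rewrite map_inj_uniq ?enum_uniq //.
  by elim: a => [|a IH] x y //= /(can_inj fK) /IH.
move=> x; rewrite mem_enum; apply/mapP; exists (iter a g x).
  by rewrite mem_enum.
by elim: a x => [|a IH] x //; rewrite iterSr [iter a.+1 g x]iterS gK -IH.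
Qed.

(** Starting arcs may be translated by a positions because the translation is a
    bijection of the arcs. *)
Lemma perm_walk_colors m a s : stays_in m a s ->
  perm_eq [seq window f1 c1 m e | e <- enum T1]
          [seq window f2 c2 m e | e <- enum T2] ->
  perm_eq [seq walk_colors f1 g1 c1 s e | e <- enum T1]
          [seq walk_colors f2 g2 c2 s e | e <- enum T2].
Proof.
move=> h hp.
have aux (T : finType) (f g : T -> T) (c : T -> C) : cancel f g ->
    cancel g f -> perm_eq [seq walk_colors f g c s e | e <- enum T]
      [seq read_along x0 z a s | z <- [seq window f c m e | e <- enum T]].
  move=> fK gK; rewrite -map_comp perm_sym.
  rewrite -(eq_map (fun e => walk_colors_read c x0 e fK h)).
  by rewrite (map_comp (walk_colors f g c s)); apply/perm_map/perm_enum_can.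
apply: (perm_trans (aux _ _ _ c1 f1K g1K)).
rewrite perm_sym; apply: (perm_trans (aux _ _ _ c2 f2K g2K)).
by apply: perm_map; rewrite perm_sym.
Qed.

(** For walks of k + 1 steps, every sign sequence except the constant one is
    confined to a window of length k + 1, where the induction hypothesis
    applies.  Cancelling these terms isolates the straight walks, whose words
    are the windows of length k + 2. *)
Lemma perm_windows :
  perm_eq [seq window f1 c1 1 e | e <- enum T1]
          [seq window f2 c2 1 e | e <- enum T2] ->
  (forall k x,
     \sum_(s <- signs k)
        count_mem x [seq walk_colors f1 g1 c1 (true :: s) e | e <- enum T1] =
     \sum_(s <- signs k)
        count_mem x [seq walk_colors f2 g2 c2 (true :: s) e | e <- enum T2]) ->
  forall m, perm_eq [seq window f1 c1 m.+1 e | e <- enum T1]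
                    [seq window f2 c2 m.+1 e | e <- enum T2].
Proof.
move=> h1 hW; elim=> [|k IH] //.
apply/allP => x _; apply/eqP.
have hin : nseq k true \in signs k by rewrite mem_signs size_nseq.
have := hW k x; rewrite !(bigD1_seq _ hin (signs_uniq k)) /=.
have -> : \sum_(s <- signs k | s != nseq k true)
    count_mem x [seq walk_colors f1 g1 c1 (true :: s) e | e <- enum T1] =
  \sum_(s <- signs k | s != nseq k true)
    count_mem x [seq walk_colors f2 g2 c2 (true :: s) e | e <- enum T2].
  rewrite big_seq_cond [RHS]big_seq_cond; apply: eq_bigr => s.
  rewrite mem_signs => /andP[/eqP sk]; rewrite -sk => /bent_stays_in[a].
  rewrite sk => ha.
  exact: (seq.permP (perm_walk_colors ha IH)).
move/addIn.
by rewrite (eq_map (walk_colors_straight f1 g1 c1 k.+1))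
  (eq_map (walk_colors_straight f2 g2 c2 k.+1)).
Qed.

End TwoLines.

(** * Leaves, pruning, and connected graphs with as many edges as vertices *)

Section OneGraph.
Variable G : sgraph.
Implicit Types (S : {set G}) (x y : G).

Definition sdeg S x := #|[set y in S | edge x y]|.
Definition leaves S := [set x in S | sdeg S x == 1].
Definition prune S := S :\: leaves S.

(** Connectedness of the subgraph induced on S, in the form in which Laplacian
    kernels provide it and pruning preserves it. *)
Definition connected_in S := forall p : pred G,
  {in S &, forall x y, edge x y -> p x = p y} -> {in S &, forall x y, p x = p y}.

(** The degree sum is twice the number of edges, so these are the nonempty
    connected induced subgraphs with as many edges as vertices. *)
Definition one_cycle S :=
  [/\ S != set0, connected_in S & \sum_(x in S) sdeg S x = 2 * #|S|].

(** For a leaf this is its only neighbour; the default value x is reached only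
    at vertices that have no neighbour in S. *)
Definition stem S x := odflt x [pick y in S | edge x y].

Lemma leavesS S : leaves S \subset S.
Proof. by apply/subsetP => x; rewrite inE => /andP[]. Qed.

Lemma in_prune S x : (x \in prune S) = (x \notin leaves S) && (x \in S).
Proof. by rewrite in_setD. Qed.

Lemma stemP S l : l \in leaves S ->
  [/\ stem S l \in S, edge l (stem S l)
    & {in S, forall y, edge l y = (y == stem S l)}].
Proof.
rewrite inE => /andP[lS /cards1P[z hz]].
have h y : (y \in S) && edge l y = (y == z).
  by have /setP/(_ y) := hz; rewrite !inE.
have -> : stem S l = z.
  rewrite /stem; case: pickP => [y|/(_ z)]; first by rewrite h => /eqP.
  by rewrite h eqxx.
have /andP[zS lz] : (z \in S) && edge l z by rewrite h.
by split=> // y yS; rewrite -h yS.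
Qed.

(** Two adjacent leaves would form a connected component, hence all of S, and
    a single edge has fewer edges than vertices. *)
Lemma stem_prune S l : one_cycle S -> l \in leaves S -> stem S l \in prune S.
Proof.
case=> S0 cS sumS lL; have [pS lp hl] := stemP lL.
rewrite in_prune pS andbT; apply/negP => pL.
have [_ _ hp] := stemP pL.
have lS := subsetP (leavesS S) _ lL.
have epl : stem S (stem S l) = l by apply/esym/eqP; rewrite -hp // edge_sym.
pose p := pred2 l (stem S l).
have pS' : {in S &, forall x y, p x = p y}.
  apply: cS => x y xS yS; wlog px : x y xS yS / p x.
    move=> W; case px: (p x); first by rewrite -px; apply: W.
    case py: (p y) => //; rewrite edge_sym => e.
    by rewrite -px -py (W y x).
  rewrite px; case/orP: px => /eqP ->.
    by rewrite hl // => /eqP ->; rewrite /p /= eqxx orbT.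
  by rewrite hp // epl => /eqP ->; rewrite /p /= eqxx.
have SL x : x \in S -> sdeg S x = 1.
  move=> xS; have : p x by rewrite (pS' x l) //= /p /= eqxx.
  suff : x \in leaves S -> sdeg S x = 1.
    by move=> h /orP[] /eqP e; apply: h; rewrite e.
  by rewrite inE => /andP[_ /eqP].
move: sumS; rewrite (eq_bigr _ SL) sum1_card => h.
by move: S0; rewrite -card_gt0; lia.
Qed.

Lemma sdeg_prune S x : sdeg S x = sdeg (prune S) x + sdeg (leaves S) x.
Proof.
rewrite /sdeg -(cardsID (leaves S) [set y in S | edge x y]) addnC.
congr (_ + _); apply: eq_card => y; rewrite !inE.
  by rewrite andbA.
by case: (y \in S); rewrite ?andbF //= andbC.
Qed.

(** Each leaf contributes 1 to the degree sum by itself and 1 at its stem, which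
    is exactly twice its contribution to the number of vertices. *)
Lemma sum_sdeg_prune S : one_cycle S ->
  \sum_(x in prune S) sdeg (prune S) x = 2 * #|prune S|.
Proof.
move=> h; have [S0 cS sumS] := h.
have split_sum F : \sum_(x in S) F x =
    \sum_(x in leaves S) F x + \sum_(x in prune S) F x.
  rewrite (big_setID (leaves S)) /=; congr (_ + _).
  by rewrite (setIidPr (leavesS S)).
have sL : \sum_(x in leaves S) sdeg S x = #|leaves S|.
  by rewrite -sum1_card; apply: eq_bigr => x; rewrite inE => /andP[_ /eqP].
have sR : \sum_(x in prune S) sdeg (leaves S) x = #|leaves S|.
  rewrite -sum1_card (eq_bigr (fun x => \sum_(l in leaves S | edge x l) 1));
    last by move=> x _; rewrite sum1_card /sdeg cardsE.
  rewrite (exchange_big_dep (mem (leaves S))) //=; last by move=> x l _ /andP[].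
  apply: eq_bigr => l lL; have [_ _ hl] := stemP lL.
  rewrite (big_pred1 (stem S l)) // => x; rewrite /= lL /=.
  apply/andP/eqP => [[]|->].
    by rewrite in_prune => /andP[_ xS]; rewrite edge_sym hl // => /eqP.
  by split; [exact: stem_prune | rewrite edge_sym hl //; case: (stemP lL)].
have cc : #|S| = #|leaves S| + #|prune S|.
  by rewrite -(cardsID (leaves S) S) (setIidPr (leavesS S)).
move: sumS; rewrite split_sum sL cc.
rewrite (eq_bigr (fun x => sdeg (prune S) x + sdeg (leaves S) x));
  last by move=> x _; exact: sdeg_prune.
by rewrite big_split /= sR; lia.
Qed.

(** A locally constant predicate on the pruned set extends to the leaves by its
    value at the stem, which gives connectedness. *)
Lemma one_cycle_prune S : one_cycle S -> one_cycle (prune S).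
Proof.
move=> h; have [S0 cS _] := h; split; last exact: sum_sdeg_prune.
  have [x xS] := set0Pn _ S0; apply/set0Pn.
  case xL: (x \in leaves S); first by exists (stem S x); apply: stem_prune.
  by exists x; rewrite in_prune xL.
move=> p hp.
pose q x := if x \in leaves S then p (stem S x) else p x.
have hq : {in S &, forall x y, q x = q y}.
  apply: cS => x y xS yS e; rewrite /q.
  case xL: (x \in leaves S); case yL: (y \in leaves S) => //.
  - have [_ _ hx] := stemP xL; move: e; rewrite hx // => /eqP E.
    by have := stem_prune h xL; rewrite -E in_prune yL.
  - by have [_ _ hx] := stemP xL; move: e; rewrite hx // => /eqP ->.
  - by have [_ _ hx] := stemP yL; move: e; rewrite edge_sym hx // => /eqP ->.
  by apply: hp; rewrite // in_prune ?xL ?yL.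
move=> x y; rewrite !in_prune => /andP[/negbTE xL xS] /andP[/negbTE yL yS].
by have := hq x y xS yS; rewrite /q xL yL; apply.
Qed.

(** Without leaves all degrees are at least 2, and their average is 2. *)
Lemma no_leaf_sdeg S : one_cycle S -> leaves S = set0 ->
  {in S, forall x, sdeg S x = 2}.
Proof.
case=> S0 cS sumS L0.
have ge2 x : x \in S -> 2 <= sdeg S x.
  move=> xS; have n1 : sdeg S x != 1.
    by apply/negP => e; have := in_set0 x; rewrite -L0 inE xS e.
  have n0 : sdeg S x != 0.
    apply/negP; rewrite cards_eq0 => /eqP /setP h.
    have px : {in S &, forall y z, pred1 x y = pred1 x z}.
      apply: cS => y z yS zS e.
      have E u : u \in S -> edge x u = false.
        by move=> uS; have := h u; rewrite !inE uS.
      rewrite /=; case: eqP => [yx|_]; first by rewrite yx E in e.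
      by case: eqP => // zx; rewrite zx edge_sym E in e.
    have Sx : S = [set x].
      apply/setP => y; rewrite inE; apply/idP/eqP => [yS|-> //].
      by apply/eqP; have /= -> := px y x yS xS; apply: eqxx.
    move: sumS; rewrite [in LHS]Sx big_set1 Sx cards1.
    suff -> : sdeg [set x] x = 0 by [].
    by apply/eqP; rewrite cards_eq0 -Sx; apply/eqP/setP.
  by lia.
have /eqP : \sum_(x in S) (sdeg S x - 2) = 0.
  rewrite sumnB // sumS sum_nat_const; lia.
by rewrite sum_nat_eq0 => /forall_inP h x xS; have := h x xS; have := ge2 x xS; lia.
Qed.

End OneGraph.

(** * Connected 2-regular graphs as orbits of an arc rotation *)

Section Arcs.
Variables (G : sgraph) (S : {set G}).
Hypothesis reg2 : {in S, forall x, sdeg S x = 2}.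

Definition arc := {p : G * G | [&& p.1 \in S, p.2 \in S & edge p.1 p.2]}.

(** The neighbour of y by which a walk that came from x leaves without turning
    back. *)
Definition other x y := odflt y [pick z in S | edge y z && (z != x)].

Lemma otherP x y : x \in S -> y \in S -> edge x y ->
  [/\ other x y \in S, edge y (other x y), other x y != x &
    {in S, forall w, edge y w = (w == x) || (w == other x y)}].
Proof.
move=> xS yS xy; have /eqP/cards2P[a [b [ab h]]] := reg2 yS.
have E w : (w \in S) && edge y w = (w == a) || (w == b).
  by have /setP/(_ w) := h; rewrite !inE.
have : (x == a) || (x == b) by rewrite -E xS edge_sym.
rewrite /other; case: pickP => [z /and3P[zS yz zx] xab|nz xab]; last first.
  have [z zab zx] : exists2 z, (z == a) || (z == b) & z != x.
    case/orP: xab => /eqP ->; [exists b|exists a]; rewrite ?eqxx ?orbT //.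
    by rewrite eq_sym.
  by move: zab (nz z); rewrite -E => /andP[-> ->]; rewrite zx.
split=> //= w wS; move: (E w) (E z); rewrite wS zS yz /= => -> /esym zab.
case/orP: xab zx zab => /eqP ->.
  by move=> /negbTE -> /= /eqP ->.
by move=> /negbTE ->; rewrite orbF => /eqP ->; rewrite orbC.
Qed.

Lemma otherK x y : x \in S -> y \in S -> edge x y -> other (other x y) y = x.
Proof.
move=> xS yS xy; have [zS yz zx hz] := otherP xS yS xy.
have zy : edge (other x y) y by rewrite edge_sym.
have [uS yu uz hu] := otherP zS yS zy.
by move: yu; rewrite hz // (negbTE uz) orbF => /eqP.
Qed.

Definition tail (a : arc) : G := (val a).1.
Definition next_arc (a : arc) : arc :=
  insubd a ((val a).2, other (val a).1 (val a).2).
Definition prev_arc (a : arc) : arc :=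
  insubd a (other (val a).2 (val a).1, (val a).1).
Definition rev_arc (a : arc) : arc := insubd a ((val a).2, (val a).1).

Lemma arcP (a : arc) :
  [/\ (val a).1 \in S, (val a).2 \in S & edge (val a).1 (val a).2].
Proof. exact/and3P/(valP a). Qed.

Lemma val_next a : val (next_arc a) = ((val a).2, other (val a).1 (val a).2).
Proof.
have [xS yS xy] := arcP a; have [zS yz _ _] := otherP xS yS xy.
by rewrite val_insubd /= yS zS yz.
Qed.

Lemma val_rev a : val (rev_arc a) = ((val a).2, (val a).1).
Proof.
have [xS yS xy] := arcP a.
by rewrite val_insubd /= yS xS edge_sym xy.
Qed.

Lemma val_prev a : val (prev_arc a) = (other (val a).2 (val a).1, (val a).1).
Proof.
have [xS yS xy] := arcP a; rewrite edge_sym in xy.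
have [zS yz _ _] := otherP yS xS xy.
by rewrite val_insubd /= xS zS edge_sym yz.
Qed.

Lemma next_arcK : cancel next_arc prev_arc.
Proof.
move=> a; have [xS yS xy] := arcP a; apply: val_inj.
by rewrite val_prev val_next /= otherK //; case: (val a).
Qed.

Lemma prev_arcK : cancel prev_arc next_arc.
Proof.
move=> a; have [xS yS xy] := arcP a; apply: val_inj.
by rewrite val_next val_prev /= otherK ?(edge_sym _ (val a).1) //; case: (val a).
Qed.

Lemma rev_arcK : involutive rev_arc.
Proof. by move=> a; apply: val_inj; rewrite !val_rev /=; case: (val a). Qed.

Lemma rev_next a : rev_arc (next_arc a) = prev_arc (rev_arc a).
Proof. by apply: val_inj; rewrite val_rev val_next val_prev val_rev. Qed.

Lemma tail_next a : tail (next_arc a) = (val a).2.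
Proof. by rewrite /tail val_next. Qed.

Lemma tail_prev a : tail (prev_arc a) = other (val a).2 (val a).1.
Proof. by rewrite /tail val_prev. Qed.

Lemma tailS a : tail a \in S. Proof. by case: (arcP a). Qed.

Lemma edge_tail a : {in S, forall w, edge (tail a) w =
  (w == tail (next_arc a)) || (w == tail (prev_arc a))}.
Proof.
move=> w wS; have [xS yS xy] := arcP a; rewrite edge_sym in xy.
have [_ _ _ h] := otherP yS xS xy.
by rewrite tail_next tail_prev; apply: h.
Qed.

Lemma tail_next_prev a : tail (next_arc a) != tail (prev_arc a).
Proof.
have [xS yS xy] := arcP a; rewrite edge_sym in xy.
have [_ _ h _] := otherP yS xS xy.
by rewrite tail_next tail_prev eq_sym.
Qed.

(** If m rotations reverse an arc, then m - 2 rotations reverse the next arc;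
    this ends at a loop or at a vertex whose two neighbours coincide. *)
Lemma no_reversal m a : iter m next_arc a != rev_arc a.
Proof.
elim/ltn_ind: m a => -[|[|m]] IH a.
- apply/eqP => /(congr1 val); rewrite val_rev /=; have [_ _ /=] := arcP a.
  by case: (sval a) => x y /= xy [e _]; rewrite e edge_irrefl in xy.
- have [xS yS xy] := arcP a; have [_ _ /eqP zx _] := otherP xS yS xy.
  by apply/eqP => /(congr1 val); rewrite val_rev val_next; case; apply: zx.
- apply/eqP; rewrite iterS => /(congr1 prev_arc).
  rewrite next_arcK -rev_next iterSr; apply/eqP; exact: IH.
Qed.

(** Of the two arcs that leave a vertex, one is the reverse of the predecessor
    of the other, so meeting both in one orbit would contradict
    [no_reversal]. *)
Lemma tail_iter_inj m a :
  tail (iter m next_arc a) = tail a -> iter m next_arc a = a.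
Proof.
set b := iter m _ a => e; apply/eqP/negPn/negP => nab.
have E : next_arc (rev_arc b) = a.
  apply: (can_inj prev_arcK); rewrite next_arcK; apply: val_inj.
  rewrite val_rev val_prev.
  have [xS yS xy] := arcP a; rewrite edge_sym in xy.
  have [_ _ _ h] := otherP yS xS xy.
  have [x'S y'S] := arcP b; rewrite -/(tail b) e h //.
  case/orP => /eqP e2; last by congr pair.
  case/eqP: nab; apply: val_inj; move: e e2; rewrite /tail.
  by case: (val a) (val b) => ? ? [? ?] /= -> ->.
have := no_reversal m.+1 (rev_arc b).
by rewrite iterSr E rev_arcK eqxx.
Qed.

Lemma next_arc_inj : injective next_arc.
Proof. exact: can_inj next_arcK. Qed.

Lemma tail_orbit_inj a : {in orbit next_arc a &, injective tail}.
Proof.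
move=> b b'; rewrite -!fconnect_orbit => ab ab' e.
have : fconnect next_arc b b'.
  by apply: connect_trans ab'; rewrite fconnect_sym //; apply: next_arc_inj.
by move=> /iter_findex E; move: e; rewrite -E => /esym /tail_iter_inj.
Qed.

Hypothesis connS : connected_in S.

(** The vertices met by the orbit form a set closed under adjacency. *)
Lemma tail_orbit a : [seq tail b | b <- orbit next_arc a] =i S.
Proof.
pose p x := x \in [seq tail b | b <- orbit next_arc a].
have step x y : x \in S -> y \in S -> edge x y -> p x -> p y.
  move=> xS yS xy /mapP[b]; rewrite -fconnect_orbit => ab e.
  move: xy; rewrite e edge_tail // => /orP[] /eqP ->; apply: map_f;
    rewrite -fconnect_orbit.
    exact: connect_trans ab (fconnect1 _ _).
  apply: connect_trans ab _; rewrite fconnect_sym; last exact: next_arc_inj.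
  by rewrite -{2}(prev_arcK b) fconnect1.
have pE : {in S &, forall x y, p x = p y}.
  apply: connS => x y xS yS xy; apply/idP/idP; first exact: step xy.
  by apply: step => //; rewrite edge_sym.
move=> x; apply/idP/idP => [/mapP[b _ ->]|xS]; first exact: tailS.
rewrite -[_ \in _]/(p x) (pE x (tail a)) ?tailS //; apply: map_f.
by rewrite -fconnect_orbit connect0.
Qed.

Lemma order_next a : order next_arc a = #|S|.
Proof.
rewrite -(eq_card (tail_orbit a)) (card_uniqP _) ?size_map ?size_orbit //.
by rewrite map_inj_in_uniq ?orbit_uniq //; apply: tail_orbit_inj.
Qed.

Definition at_step (a : arc) i := tail (iter i next_arc a).

Lemma iter_next_eq a i j : i < #|S| -> j < #|S| ->
  (iter i next_arc a == iter j next_arc a) = (i == j).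
Proof.
rewrite -(order_next a) => ltid ltjd.
have := nth_uniq a (s := orbit next_arc a); rewrite size_orbit.
by move=> /(_ i j ltid ltjd (orbit_uniq _ _)); rewrite !nth_traject.
Qed.

Lemma at_step_inj a : {in gtn #|S| &, injective (at_step a)}.
Proof.
move=> i j; rewrite !inE => li lj /tail_orbit_inj e.
have h k : iter k next_arc a \in orbit next_arc a.
  by rewrite -fconnect_orbit fconnect_iter.
by apply/eqP; rewrite -(iter_next_eq a) //; apply/eqP; apply: e; apply: h.
Qed.

Lemma at_step_onto a x : x \in S -> exists2 i, i < #|S| & at_step a i = x.
Proof.
rewrite -(tail_orbit a) => /mapP[b]; rewrite -fconnect_orbit => ab ->.
exists (findex next_arc a b); first by rewrite -(order_next a) findex_max.
by rewrite /at_step iter_findex.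
Qed.

Lemma iter_next_mod a i : iter (i %% #|S|) next_arc a = iter i next_arc a.
Proof.
rewrite [in RHS](divn_eq i #|S|) addnC iterD; congr iter.
elim: (i %/ _) => //= q IH; rewrite mulSn iterD -IH -(order_next a).
by rewrite iter_order //; apply: next_arc_inj.
Qed.

Lemma edge_at_step a i j : i < #|S| -> j < #|S| ->
  edge (at_step a i) (at_step a j) =
    (j == i.+1 %% #|S|) || (i == j.+1 %% #|S|).
Proof.
move=> li lj; have S0 : 0 < #|S| by apply: leq_ltn_trans li.
rewrite /at_step edge_tail ?tailS // -!(iter_next_eq a) ?ltn_mod //.
rewrite !iter_next_mod /= -[X in _ = _ || (X == _)](prev_arcK (iter i _ _)).
rewrite (inj_eq next_arc_inj) [X in _ = _ || X]eq_sym.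
have h k : iter k next_arc a \in orbit next_arc a.
  by rewrite -fconnect_orbit fconnect_iter.
have hp : prev_arc (iter i next_arc a) \in orbit next_arc a.
  rewrite -fconnect_orbit (connect_trans (fconnect_iter next_arc i a)) //.
  rewrite fconnect_sym; last exact: next_arc_inj.
  by rewrite -{2}(prev_arcK (iter i next_arc a)) fconnect1.
by rewrite !(inj_in_eq (@tail_orbit_inj a)) // -iterS.
Qed.

End Arcs.

(** * Coloured cycles are determined by their coloured walk counts *)

Section Walks.
Variables (C : eqType) (G : sgraph) (S : {set G}) (col : G -> C).

(** The number of walks w1, ..., wk in S with colour word xs such that v, w1 is
    an edge: the continuations of a walk that has reached v. *)
Fixpoint extensions (xs : seq C) (v : G) : nat :=
  if xs is c :: xs' then
    \sum_(w in S | edge v w && (col w == c)) extensions xs' w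
  else 1.

Definition colored_walks c xs := \sum_(v in S | col v == c) extensions xs v.

Hypothesis reg2 : {in S, forall x, sdeg S x = 2}.

Local Notation arc := (arc S).
Local Notation acol := (fun a : arc => col (tail a)).
Local Notation next := (@next_arc G S).
Local Notation prev := (@prev_arc G S).

Lemma sum_arcs (F : G -> G -> nat) :
  \sum_(a : arc) F (tail a) (tail (next a)) =
  \sum_(v in S) \sum_(w in S | edge v w) F v w.
Proof.
rewrite (eq_bigr (fun a : arc => F (val a).1 (val a).2)); last first.
  by move=> a _; rewrite tail_next.
rewrite pair_big_dep /=.
rewrite (reindex_omap (val : arc -> G * G) insub) /=; last first.
  by move=> p hp; rewrite insubT //= ?andbA // => q; congr Some.
apply: eq_bigl => a; rewrite valK eqxx andbT.
by have [-> -> ->] := arcP a.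
Qed.

Lemma sum_neighbors (F : G -> nat) (a : arc) :
  \sum_(w in S | edge (tail a) w) F w = F (tail (next a)) + F (tail (prev a)).
Proof.
have hn := tail_next_prev reg2 a; have he := edge_tail reg2 a.
rewrite (bigD1 (tail (next a))) /=; last first.
  by rewrite tailS he ?tailS // eqxx.
rewrite (bigD1 (tail (prev a))) /=; last first.
  by rewrite tailS he ?tailS // eqxx orbT eq_sym.
rewrite big1 ?addn0 // => w /andP[/andP[/andP[wS]]].
by rewrite he // => /orP[] ->; rewrite ?andbF.
Qed.

(** Once the cycle is oriented by an arc at v, the walks from v correspond to sign
    sequences, because every vertex has one neighbour forward and one
    backward. *)
Lemma extensions_walks xs a :
  \sum_(s <- signs (size xs))
     (walk_colors next prev acol s a == acol a :: xs) = extensions xs (tail a).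
Proof.
elim: xs a => [|c xs IH] a /=; first by rewrite big_seq1 eqxx.
rewrite big_cat !big_map /=.
have step (b : arc) : \sum_(s <- signs (size xs))
    (acol a :: walk_colors next prev acol s b == [:: acol a, c & xs]) =
    (if acol b == c then extensions xs (tail b) else 0).
  case: eqP => [<-|ne].
    rewrite -IH; apply: eq_bigr => s _.
    by rewrite eqseq_cons eqxx.
  rewrite big1 // => s _; rewrite eqseq_cons eqxx /=.
  by case: s => [|? ?]; rewrite /= eqseq_cons (introF eqP ne).
rewrite !step.
rewrite -(sum_neighbors (fun w => if col w == c then extensions xs w else 0)).
by rewrite -big_mkcondr; apply: eq_bigl => w; rewrite andbA.
Qed.

(** The first edge of a walk is an arc, and orienting the cycle along it makes
    the first sign positive; so each walk is counted once. *)
Lemma count_walks c x xs :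
  \sum_(s <- signs (size xs))
     count_mem [:: x, c & xs]
       [seq walk_colors next prev acol (true :: s) e | e <- enum {: arc}] =
  colored_walks x (c :: xs).
Proof.
have E s : count_mem [:: x, c & xs]
    [seq walk_colors next prev acol (true :: s) e | e <- enum {: arc}] =
  \sum_(e : arc) ((acol e == x) &&
    (walk_colors next prev acol s (next e) == c :: xs)).
  rewrite count_map -sum1_count big_enum_cond big_mkcond /=.
  by apply: eq_bigr => e _; rewrite eqseq_cons; case: andP.
rewrite (eq_bigr _ (fun s _ => E s)) exchange_big /=.
rewrite (eq_bigr (fun e : arc => (acol e == x) *
    ((acol (next e) == c) * extensions xs (tail (next e))))); last first.
  move=> e _; rewrite -extensions_walks !big_distrr /=; apply: eq_bigr => s _.
  rewrite -mulnb; congr (_ * _); case: s => [|b s] /=;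
    by rewrite !eqseq_cons eqxx /= ?mulnb.
rewrite (sum_arcs (fun v w => (col v == x) * ((col w == c) * extensions xs w))).
rewrite /colored_walks [RHS]big_mkcondr /=; apply: eq_bigr => v _.
rewrite -big_distrr /=; case: (col v == x); rewrite ?mul0n ?mul1n //.
under [RHS]eq_bigl do rewrite andbA.
rewrite [RHS]big_mkcondr; apply: eq_bigr => w _.
by case: (col w == c); rewrite ?mul1n.
Qed.

Lemma count_window1 x :
  count_mem [:: x] [seq window next acol 1 e | e <- enum {: arc}] =
  2 * colored_walks x [::].
Proof.
rewrite count_map -sum1_count big_enum_cond big_mkcond /=.
rewrite (eq_bigr (fun e : arc => (col (tail e) == x) : nat)); last first.
  by move=> e _; rewrite /window /= eqseq_cons andbT; case: eqP.
rewrite (sum_arcs (fun v w => (col v == x) : nat)).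
rewrite /colored_walks [in RHS]big_mkcondr big_distrr /=; apply: eq_bigr => v vS.
rewrite sum_nat_const; have := reg2 vS; rewrite /sdeg cardsE => ->.
by case: (col v == x).
Qed.

End Walks.

Lemma count_walks_size (C : eqType) (T : finType) (f g : T -> T) (c : T -> C)
    k x : size x != k.+2 ->
  \sum_(s <- signs k)
     count_mem x [seq walk_colors f g c (true :: s) e | e <- enum T] = 0.
Proof.
move=> sx; rewrite big_seq big1 // => s; rewrite mem_signs => /eqP sk.
apply/count_memPn/mapP => -[e _ ex]; case/eqP: sx; rewrite ex -sk {ex}.
have sz s' e' : size (walk_colors f g c s' e') = (size s').+1.
  by elim: s' e' => //= b s' IH e'; rewrite IH.
by rewrite sz.
Qed.

Section CycleIso.
Variables (C : eqType) (G1 G2 : sgraph) (S1 : {set G1}) (S2 : {set G2}).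
Variables (col1 : G1 -> C) (col2 : G2 -> C).

Definition iso_on (f : G1 -> G2) :=
  [/\ {in S1 &, injective f}, f @: S1 = S2,
      {in S1 &, forall x y, edge (f x) (f y) = edge x y} &
      {in S1, forall x, col2 (f x) = col1 x}].

Hypotheses (reg1 : {in S1, forall x, sdeg S1 x = 2}) (conn1 : connected_in S1).
Hypotheses (reg2 : {in S2, forall x, sdeg S2 x = 2}) (conn2 : connected_in S2).
Hypotheses (card12 : #|S1| = #|S2|).

(** Windows whose length is the number of vertices contain the whole coloured
    cycle.  An arc b of the second graph with the same window as an arc a of the
    first one gives the isomorphism that sends the i-th vertex after a to the
    i-th vertex after b. *)
Lemma cycle_iso : S1 != set0 ->
  (forall c xs, colored_walks S1 col1 c xs = colored_walks S2 col2 c xs) ->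
  exists f, iso_on f.
Proof.
case/set0Pn=> x0 x0S hW.
have /set0Pn[y0] : [set y in S1 | edge x0 y] != set0.
  by rewrite -card_gt0 -/(sdeg S1 x0) reg1.
rewrite inE => /andP[y0S x0y0].
have h0 : [&& (x0, y0).1 \in S1, (x0, y0).2 \in S1 & edge (x0, y0).1 (x0, y0).2].
  by rewrite /= x0S y0S.
pose a : arc S1 := exist _ (x0, y0) h0.
pose n := #|S1|.
have n0 : 0 < n by apply/card_gt0P; exists x0.
have hP : perm_eq
    [seq window (@next_arc _ S1) (col1 \o @tail _ S1) n e | e <- enum {: arc S1}]
    [seq window (@next_arc _ S2) (col2 \o @tail _ S2) n e | e <- enum {: arc S2}].
  rewrite -(prednK n0).
  apply: (perm_windows (col1 x0) (next_arcK reg1) (prev_arcK reg1)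
    (next_arcK reg2) (prev_arcK reg2)).
    apply/allP => z _; apply/eqP; case: z => [|z [|z' zs]].
    - rewrite !(count_memPn _) //; apply/mapP => -[e _]; rewrite windowS //.
    - by rewrite !count_window1 // hW.
    - rewrite !(count_memPn _) //; apply/mapP => -[e _]; rewrite windowS //.
  move=> k z; case: (eqVneq (size z) k.+2) => [|ne]; last first.
    by rewrite !count_walks_size.
  by case: z => [|c [|c' z]] //= -[<-]; rewrite !count_walks // hW.
have /mapP[b _ hb] : window (@next_arc _ S1) (col1 \o @tail _ S1) n a \in
    [seq window (@next_arc _ S2) (col2 \o @tail _ S2) n e | e <- enum {: arc S2}].
  by rewrite -(perm_mem hP); apply: map_f; rewrite mem_enum.
have colab i : i < n -> col2 (at_step b i) = col1 (at_step a i).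
  move=> li; have := congr1 (fun s => nth (col1 x0) s i) hb.
  by rewrite !(nth_map 0) ?size_iota // nth_iota.
pose idx x := index x [seq at_step a i | i <- iota 0 n].
pose f x := at_step b (idx x).
have fE i : i < n -> f (at_step a i) = at_step b i.
  move=> li; rewrite /f /idx; congr at_step.
  have -> : at_step a i = nth x0 [seq at_step a i | i <- iota 0 n] i.
    by rewrite (nth_map 0) ?size_iota // nth_iota.
  rewrite index_uniq ?size_map ?size_iota // map_inj_in_uniq ?iota_uniq //.
  by move=> j k; rewrite !mem_iota; apply: at_step_inj.
have fI : {in S1 &, injective f}.
  move=> x y /(at_step_onto reg1 conn1 a)[i li <-].
  move=> /(at_step_onto reg1 conn1 a)[j lj <-]; rewrite !fE // => e.
  congr at_step; apply: (at_step_inj reg2 conn2 _ _ e); by rewrite inE -card12.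
exists f; split=> //.
- apply/eqP; rewrite eqEcard card_in_imset // card12 leqnn andbT.
  apply/subsetP => y /imsetP[x /(at_step_onto reg1 conn1 a)[i li <-] ->].
  by rewrite fE //; apply: tailS.
- move=> x y /(at_step_onto reg1 conn1 a)[i li <-].
  move=> /(at_step_onto reg1 conn1 a)[j lj <-]; rewrite !fE //.
  by rewrite !edge_at_step // -?card12.
- by move=> x /(at_step_onto reg1 conn1 a)[i li <-]; rewrite fE // colab.
Qed.

End CycleIso.

(** * A unicyclic graph has as many edges as vertices *)

(** The parent of a vertex is a neighbour closer to the root r, and d is the
    distance to r; the edges between vertices and their parents form a
    spanning tree. *)
Lemma spanning_parent (G : sgraph) (r : G) : connected_graph G ->
  exists (d : G -> nat) (par : G -> G),
    forall x, x != r -> edge x (par x) /\ d (par x) < d x.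
Proof.
move=> cG.
pose reach x n := [exists p : n.-tuple G, path (@edge G) r p && (last r p == x)].
have hex x : exists n, reach x n.
  have /connectP[p hp ->] := cG r x; exists (size p).
  by apply/existsP; exists (in_tuple p); rewrite /= hp /=.
pose d x := ex_minn (hex x).
exists d, (fun x => odflt x [pick y | edge x y && (d y < d x)]) => x xr.
have dP u : reach u (d u) /\ forall n, reach u n -> d u <= n.
  by rewrite /d; case: ex_minnP.
case: pickP => [y /andP[] //|no_y]; exfalso.
have [/existsP[p /andP[hp /eqP lp]] _] := dP x.
case: (lastP (val p)) hp lp (size_tuple p) => [_ e|p' z].
  by rewrite -e eqxx in xr.
rewrite rcons_path last_rcons size_rcons => /andP[hp' ez] zx sp; subst z.
have := no_y (last r p'); rewrite edge_sym ez /= => /negbT; rewrite -leqNgt -sp.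
have [_ /(_ (size p'))] := dP (last r p').
have -> : reach (last r p') (size p').
  by apply/existsP; exists (in_tuple p'); rewrite /= hp' /=.
by move=> /(_ isT); lia.
Qed.

(** An edge x y outside of e closes a simple path of e-edges from x to y; the
    path has at least two edges because x y is not one of e. *)
Lemma closing_edge (G : sgraph) (e : rel G) (x y : G) :
  subrel e (@edge G) -> edge x y -> ~~ e x y -> connect e x y ->
  exists c : seq G,
    [/\ 2 < size c, ucycle (@edge G) c, [set x; y] \in cycle_edges c &
        {in c, forall z, e z (next c z) || (z == y) && (next c z == x)}].
Proof.
move=> sub exy nexy /connectP[p0 hp0 ely]; move: ely exy nexy.
case/shortenP: hp0 => p hp up _ -> exy nexy.
pose e' := [rel u v | e u v || (u == last x p) && (v == x)].
have cyc : cycle e' (x :: p).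
  rewrite /= rcons_path /= !eqxx orbT andbT.
  by apply: sub_path hp => u v /= ->.
exists (x :: p); split.
- case: p hp exy nexy {up e' cyc} => [|z [|z' p]] //=; first by rewrite edge_irrefl.
  by rewrite andbT => ->.
- apply/andP; split=> //; rewrite /= rcons_path edge_sym exy andbT.
  exact: sub_path hp.
- rewrite setUC; apply/imsetP; exists (last x p); first exact: mem_last.
  by rewrite next_nth mem_last index_last // nth_default.
- by move=> z zc; apply: (next_cycle cyc zc).
Qed.

(** Fix a spanning tree.  Every edge outside of it lies on a cycle formed with
    tree edges only, so two such edges would lie on different cycles.  Some edge
    of the given cycle is outside the tree, since at a vertex of the cycle
    farthest from the root only one of the two cycle edges can lead to the
    parent.  Hence exactly one edge is added to the n - 1 tree edges. *)
Lemma unicyclic_one_cycle (G : sgraph) : unicyclic G -> one_cycle [set: G].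
Proof.
case=> cG [C0 [[c0 [s0 uc0 E0]] uniqC]].
case: c0 s0 uc0 E0 => // r c1 s0 uc0 E0.
have [d [par hpar]] := spanning_parent r cG.
pose up x y := (x != r) && (par x == y).
have upE x y : up x y -> edge x y /\ d y < d x.
  by case/andP=> xr /eqP <-; apply: hpar.
pose T := [rel x y | up x y || up y x].
have subT : subrel T (@edge G).
  by move=> x y /orP[] /upE[] //; rewrite edge_sym.
have symT : connect_sym T.
  by apply: sym_connect_sym => x y; rewrite /= orbC.
have conT x : connect T x r.
  elim: {x}(d x).+1 {-2}x (ltnSn (d x)) => // k IH x dx.
  have [->|xr] := eqVneq x r; first exact: connect0.
  have [_ dp] := hpar x xr.
  apply: (connect_trans (connect1 _) (IH (par x) _)); last lia.
  by rewrite /= /up xr eqxx.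
have conTT x y : connect T x y.
  by apply: connect_trans (conT x) _; rewrite symT.
have cyc_in x y : edge x y -> ~~ T x y -> [set x; y] \in C0 /\
    forall u v, [set u; v] \in C0 -> [set u; v] != [set x; y] -> T u v.
  move=> exy nT; have [c [sc uc xyc hc]] := closing_edge subT exy nT (conTT x y).
  have EC : C0 = cycle_edges c by apply: uniqC; exists c.
  rewrite EC; split=> // u v /imsetP[z zc Euv] ne.
  have Tz : T z (next c z).
    case/orP: (hc z zc) => // /andP[/eqP zy /eqP nx].
    by case/eqP: ne; rewrite Euv nx zy setUC.
  move: Euv => /setP Euv.
  have := Euv u; have := Euv v; rewrite !inE !eqxx orbT /= => /esym hv /esym hu.
  have := Euv z; have := Euv (next c z); rewrite !inE !eqxx orbT /=.
  move: hu hv; do 2![case/orP => /eqP ->] => //.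
  - by rewrite !orbb => /eqP e _; move: Tz; rewrite /= e orbb.
  - by move=> _ _; move: Tz; rewrite /= orbC.
  - by rewrite !orbb => _ /eqP e; move: Tz; rewrite /= -e ?orbb.
have [a [b [eab nTab]]] : exists a b, edge a b /\ ~~ T a b.
  case: (boolP [exists a, exists b, edge a b && ~~ T a b]).
    by case/existsP=> a /existsP[b /andP[]]; exists a, b.
  move=> no; have allT x y : edge x y -> T x y.
    move=> exy; apply/negPn/negP => nT; case/negP: no.
    by apply/existsP; exists x; apply/existsP; exists y; rewrite exy.
  exfalso; have [cyc0 un0] := andP uc0.
  have [z zc zmax] : exists2 z, z \in r :: c1 & {in r :: c1, forall y, d y <= d z}.
    have := @arg_maxnP _ r (mem (r :: c1)) d; case=> [|z zc hz].
      exact: mem_head.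
    by exists z.
  have [i p hrot] := rot_to zc.
  have pz x : x \in r :: c1 -> edge z x -> x = par z.
    move=> xc /allT /orP[/andP[_ /eqP //]|/upE[_ lt]].
    by have := zmax x xc; rewrite leqNgt lt.
  have cz : cycle (@edge G) (z :: p) by rewrite -hrot rot_cycle.
  have uz : uniq (z :: p) by rewrite -hrot rot_uniq.
  have sz : size (z :: p) = size (r :: c1) by rewrite -hrot size_rot.
  have mz x : x \in z :: p -> x \in r :: c1 by rewrite -hrot mem_rot.
  move: s0; rewrite -sz; case: p cz uz mz {hrot sz} => [|w [|w' p]] // cz uz mz _.
  move: cz; rewrite /= rcons_path /= => /and3P[ezw _ /andP[_ ez]].
  have e1 : w = par z by apply: pz => //; apply: mz; rewrite !inE eqxx orbT.
  have e2 : last w' p = par z.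
    apply: pz; last by rewrite edge_sym.
    by apply: mz; rewrite in_cons [_ \in w :: _]in_cons mem_last !orbT.
  move: uz => /= /and3P[_ wn _]; case/negP: wn.
  by rewrite e1 -e2 mem_last.
have other_edge x y : edge x y -> ~~ T x y -> [set x; y] = [set a; b].
  move=> exy nT; apply/eqP/negPn/negP => ne.
  have [xyC _] := cyc_in _ _ exy nT; have [_ h] := cyc_in _ _ eab nTab.
  by move: nT; rewrite h.
have ab : a != b by apply/eqP => e; rewrite e edge_irrefl in eab.
(* Each ordered edge is a step up the tree, a step down, or the extra edge in
   one of its two directions. *)
have decomp x y : (edge x y : nat) = up x y + up y x +
    ((x == a) && (y == b)) + ((x == b) && (y == a)).
  case exy: (edge x y); last first.
    have u1 : up x y = false by apply/negP => /upE[]; rewrite exy.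
    have u2 : up y x = false by apply/negP => /upE[]; rewrite edge_sym exy.
    have h1 : (x == a) && (y == b) = false.
      by apply/negP => /andP[/eqP xa /eqP yb]; rewrite xa yb eab in exy.
    have h2 : (x == b) && (y == a) = false.
      by apply/negP => /andP[/eqP xa /eqP yb]; rewrite xa yb edge_sym eab in exy.
    by rewrite u1 u2 h1 h2.
  case hT: (T x y).
    have h1 : (x == a) && (y == b) = false.
      by apply/negP => /andP[/eqP xa /eqP yb]; rewrite xa yb (negbTE nTab) in hT.
    have h2 : (x == b) && (y == a) = false.
      apply/negP => /andP[/eqP xa /eqP yb]; rewrite xa yb /= orbC in hT.
      by rewrite /= hT in nTab.
    rewrite h1 h2; move: hT => /=; case u1: (up x y); case u2: (up y x) => //.
    by have [_ ?] := upE _ _ u1; have [_ ?] := upE _ _ u2; lia.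
  have := other_edge x y exy (negbT hT) => /setP E.
  move/negbT: hT; rewrite negb_or => /andP[/negbTE -> /negbTE ->].
  have xy : x != y by apply/eqP => e; rewrite e edge_irrefl in exy.
  have := E x; have := E y; rewrite !inE !eqxx orbT /=.
  have abF := negbTE ab; have baF : (b == a) = false by rewrite eq_sym.
  move=> /esym /orP[] /eqP ye /esym /orP[] /eqP xe; move: xy; rewrite xe ye;
    by rewrite ?eqxx ?abF ?baF.
split.
- by apply/set0Pn; exists r.
- move=> p hp x y _ _; have /connectP[q hq ->] := cG x y.
  elim: q x hq => //= z q IH x /andP[xz /IH <-].
  by apply: hp; rewrite ?inE.
- have -> : \sum_(x in [set: G]) sdeg [set: G] x =
      \sum_(x : G) \sum_(y : G) (edge x y : nat).
    rewrite big_mkcond; apply: eq_bigr => x _.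
    rewrite inE /sdeg -sum1_card big_mkcond /=.
    by apply: eq_bigr => y _; rewrite !inE; case: edge.
  have one (x : G) : \sum_y ((x == y) : nat) = 1.
    by rewrite (bigD1 x) //= eqxx big1 // => y; rewrite eq_sym => /negbTE ->.
  have sup : \sum_(x : G) \sum_(y : G) (up x y : nat) = #|G|.-1.
    rewrite -(cardC1 r) -sum1_card [RHS]big_mkcond; apply: eq_bigr => x _.
    rewrite !inE /up; case: (x != r) => /=; last by rewrite big1.
    exact: one.
  have sab u v : \sum_(x : G) \sum_(y : G) (((x == u) && (y == v)) : nat) = 1.
    rewrite (bigD1 u) //= [X in _ + X]big1 ?addn0.
      by rewrite eqxx /= -[RHS](one v); apply: eq_bigr => y _; rewrite eq_sym.
    by move=> x /negbTE -> /=; rewrite big1.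
  rewrite (eq_bigr (fun x => \sum_y up x y + \sum_y up y x +
    \sum_y ((x == a) && (y == b)) + \sum_y ((x == b) && (y == a)))); last first.
    by move=> x _; rewrite -!big_split; apply: eq_bigr => y _; exact: decomp.
  rewrite !big_split /= !sab sup exchange_big /= sup cardsT.
  have : 0 < #|G| by apply/card_gt0P; exists r.
  by case: #|G| => // n _; rewrite -addnA addnACA !addn1 addnn mul2n.
Qed.

(** * What an intertwining matrix preserves *)

Lemma conn_const (G : sgraph) (T : eqType) (v : G -> T) : connected_in [set: G] ->
  (forall x y, edge x y -> v x = v y) -> forall x y, v x = v y.
Proof.
move=> cG hv x y; apply/eqP; rewrite eq_sym.
have := cG (fun z => v z == v x) _ x y; rewrite eqxx => <- //.
by move=> z w _ _ /hv ->.
Qed.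

Lemma card_sum (T : finType) (A : {set T}) : #|A| = \sum_x (x \in A : nat).
Proof. by rewrite -sum1_card big_mkcond; apply: eq_bigr => x _; case: ifP. Qed.

Lemma deg_sum (G : sgraph) (x : G) : deg x = \sum_y (edge x y : nat).
Proof.
rewrite /deg -sum1_card big_mkcond /=.
by apply: eq_bigr => y _; rewrite inE; case: edge.
Qed.

Section Similar.
Local Open Scope ring_scope.
Variables (F : numClosedFieldType) (G1 G2 : sgraph).
Variables (M : G1 -> G2 -> F) (N : G2 -> G1 -> F).

(** The kernel of the Laplacian. *)
Definition harmonic (G : sgraph) (v : G -> F) :=
  forall x, \sum_y (edge x y)%:R * v y = (deg x)%:R * v x.

(** The quadratic form of the Laplacian is the sum of |v x - v y|^2 over the
    edges, so it vanishes only on locally constant vectors. *)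
Lemma harmonic_edge (G : sgraph) (v : G -> F) : harmonic v ->
  forall x y, edge x y -> v x = v y.
Proof.
move=> hv.
have flow0 (x : G) : \sum_y (edge x y)%:R * (v x - v y) = 0.
  under eq_bigr do rewrite mulrBr.
  rewrite sumrB hv -mulr_suml -natr_sum; apply/eqP; rewrite subr_eq0; apply/eqP.
  by rewrite deg_sum.
(* Once the square is expanded, both halves of the sum are combinations of the
   vanishing net flows. *)
have energy : \sum_x \sum_y (edge x y)%:R * `|v x - v y| ^+ 2 = 0.
  have E x y : (edge x y)%:R * `|v x - v y| ^+ 2 =
      (v x)^* * ((edge x y)%:R * (v x - v y)) +
      (v y)^* * ((edge y x)%:R * (v y - v x)).
    by rewrite normCK rmorphB (edge_sym y x) /=; ring.
  under eq_bigr do under eq_bigr do rewrite E.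
  under eq_bigr do rewrite big_split /= -mulr_sumr flow0 mulr0 add0r.
  rewrite exchange_big /= big1 // => y _.
  by rewrite -mulr_sumr flow0 mulr0.
move=> x y xy.
have pos u w : 0 <= (edge u w)%:R * `|v u - v w| ^+ 2.
  by rewrite mulr_ge0 ?ler0n ?exprn_ge0.
have /psumr_eq0P/(_ x isT) := energy.
move=> /(_ (fun u _ => sumr_ge0 _ (fun w _ => pos u w))).
move/psumr_eq0P => /(_ (fun w _ => pos x w)) /(_ y isT) /eqP.
by rewrite xy mul1r expf_eq0 /= normr_eq0 subr_eq0 => /eqP.
Qed.

Hypothesis MN : forall x x', \sum_y M x y * N y x' = (x == x')%:R.
Hypothesis NM : forall y y', \sum_x N y x * M x y' = (y == y')%:R.
Hypothesis AM : forall x y,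
  \sum_x' (edge x x')%:R * M x' y = \sum_y' M x y' * (edge y' y)%:R.

(** Equivalently, M intertwines the diagonal matrices of f1 and f2; see
    [compat_mul]. *)
Definition compat (T : Type) (f1 : G1 -> T) (f2 : G2 -> T) :=
  forall x y, M x y != 0 -> f1 x = f2 y.

Lemma compat_mul (f1 : G1 -> nat) (f2 : G2 -> nat) : compat f1 f2 ->
  forall x y, (f1 x)%:R * M x y = M x y * (f2 y)%:R.
Proof.
move=> h x y; have [->|/h ->] := eqVneq (M x y) 0; first by rewrite mulr0 mul0r.
by rewrite mulrC.
Qed.

(** The diagonal matrices of f1 and f2 are similar through M, hence have equal
    traces. *)
Lemma compat_sum (f1 : G1 -> nat) (f2 : G2 -> nat) : compat f1 f2 ->
  (\sum_x f1 x = \sum_y f2 y)%N.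
Proof.
move=> h; apply/eqP; rewrite -(eqr_nat F) !natr_sum; apply/eqP.
transitivity (\sum_x \sum_y (f1 x)%:R * (M x y * N y x)).
  by apply: eq_bigr => x _; rewrite -mulr_sumr MN eqxx mulr1.
rewrite exchange_big; apply: eq_bigr => y _ /=.
transitivity (\sum_x (f2 y)%:R * (N y x * M x y)).
  by apply: eq_bigr => x _; rewrite mulrA (compat_mul h); ring.
by rewrite -mulr_sumr NM eqxx mulr1.
Qed.

Lemma compat_card (S1 : {set G1}) (S2 : {set G2}) :
  compat (mem S1) (mem S2) -> #|S1| = #|S2|.
Proof.
move=> h; rewrite !card_sum; apply: compat_sum => x y /h /= e.
by rewrite e.
Qed.

Hypothesis degM : compat (@deg G1) (@deg G2).
Hypothesis conn1 : connected_in [set: G1].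
Variable x0 : G1.

(** The vector of p is in the kernel of the second Laplacian, and M carries it
    into the kernel of the first. *)
Lemma harmonic_rows (p : pred G2) : (forall y y', edge y y' -> p y = p y') ->
  harmonic (fun x => \sum_y M x y * (p y)%:R).
Proof.
move=> hp x; under eq_bigr do rewrite mulr_sumr.
rewrite exchange_big mulr_sumr /=.
transitivity (\sum_y \sum_y' M x y' * (edge y' y)%:R * (p y)%:R).
  apply: eq_bigr => y _; under eq_bigr do rewrite mulrA.
  by rewrite -!mulr_suml AM.
rewrite exchange_big; apply: eq_bigr => y _ /=.
rewrite mulrA (compat_mul degM).
transitivity (\sum_y' M x y * (p y)%:R * (edge y y')%:R).
  apply: eq_bigr => y' _; case e: (edge y y'); last by rewrite !mulr0 mul0r.
  by rewrite (hp _ _ e) !mulr1.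
rewrite -mulr_sumr -natr_sum -mulrA [_%:R * _]mulrC mulrA; by rewrite deg_sum.
Qed.

Lemma harmonic_cols : harmonic (fun y => \sum_x M x y).
Proof.
move=> y; under eq_bigr do rewrite mulr_sumr.
rewrite exchange_big mulr_sumr /=.
transitivity (\sum_x \sum_x' (edge x x')%:R * M x' y).
  apply: eq_bigr => x _; rewrite AM; apply: eq_bigr => y' _.
  by rewrite mulrC edge_sym.
rewrite exchange_big; apply: eq_bigr => x _ /=.
rewrite mulrC -(compat_mul degM) -mulr_suml -natr_sum; rewrite deg_sum.
by congr (_%:R * _); apply: eq_bigr => x' _; rewrite edge_sym.
Qed.

Definition row_sum := \sum_y M x0 y.

Lemma row_sumE x : \sum_y M x y = row_sum.
Proof.
have h := harmonic_edge (@harmonic_rows predT (fun _ _ _ => erefl)).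
have := conn_const conn1 h x x0.
by rewrite /row_sum; under eq_bigr do rewrite mulr1;
   under [in RHS]eq_bigr do rewrite mulr1.
Qed.

Lemma inv_mulr (w : G2 -> F) y :
  \sum_x N y x * (\sum_y' M x y' * w y') = w y.
Proof.
under eq_bigr do rewrite mulr_sumr.
rewrite exchange_big (bigD1 y) //= [X in _ + X]big1 => [|y' ny].
  under eq_bigr do rewrite mulrA.
  by rewrite -mulr_suml NM eqxx mul1r addr0.
under eq_bigr do rewrite mulrA.
by rewrite -mulr_suml NM eq_sym (negbTE ny) mul0r.
Qed.

Lemma inv_row_sum y : (\sum_x N y x) * row_sum = 1.
Proof.
rewrite -[RHS](inv_mulr (fun=> 1) y) mulr_suml; apply: eq_bigr => x _.
by rewrite -(row_sumE x); congr (_ * _); apply: eq_bigr => y' _; rewrite mulr1.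
Qed.

Lemma row_sum_neq0 : row_sum != 0.
Proof.
have n12 : (\sum_(x : G1) 1 = \sum_(y : G2) 1)%N by apply: compat_sum.
apply/eqP => r0; have y0 : G2.
  case: (pickP G2) => // no; move: n12; rewrite !sum1_card (eq_card0 no).
  by move=> /card0_eq /(_ x0).
by have /esym/eqP := inv_row_sum y0; rewrite r0 mulr0 oner_eq0.
Qed.

(** M maps a locally constant p and the all-ones vector to constant vectors, so
    by injectivity of M they are proportional. *)
Lemma conn_transfer : connected_in [set: G2].
Proof.
move=> p hp y y' _ _.
have hp' z z' : edge z z' -> p z = p z' by apply: hp.
have h := conn_const conn1 (harmonic_edge (harmonic_rows hp')).
have E z : (p z)%:R * row_sum = \sum_z' M x0 z' * (p z')%:R.
  rewrite -[in LHS](inv_mulr (fun z => (p z)%:R) z).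
  rewrite (eq_bigr (fun x => N z x * \sum_z' M x0 z' * (p z')%:R)).
    by rewrite -mulr_suml mulrAC inv_row_sum mul1r.
  by move=> x _; rewrite (h x x0).
have /(mulIf row_sum_neq0)/eqP : (p y)%:R * row_sum = (p y')%:R * row_sum.
  by rewrite !E.
by rewrite eqr_nat; case: (p y) (p y') => [] [].
Qed.

(** The column sums are constant because their vector is harmonic; the constant
    is the row sum because the graphs have the same number of vertices. *)
Lemma col_sumE y : \sum_x M x y = row_sum.
Proof.
have h := conn_const conn_transfer (harmonic_edge harmonic_cols).
have n12 : (\sum_(x : G1) 1 = \sum_(y : G2) 1)%N by apply: compat_sum.
rewrite !sum1_card in n12.
have : \sum_x' \sum_y' M x' y' = \sum_y' \sum_x' M x' y' by exact: exchange_big.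
rewrite (eq_bigr _ (fun x _ => row_sumE x)) (eq_bigr _ (fun y' _ => h y' y)).
rewrite !sumr_const -n12 => /eqP; rewrite eqr_pMn2r; last first.
  by apply/card_gt0P; exists x0.
by move=> /eqP.
Qed.

Section Walks.
Variables (S1 : {set G1}) (S2 : {set G2}) (C : eqType).
Variables (col1 : G1 -> C) (col2 : G2 -> C).
Hypotheses (compatS : compat (mem S1) (mem S2)) (compatC : compat col1 col2).

Let u (G : sgraph) (S : {set G}) (col : G -> C) xs x : F :=
  (((x \in S) : nat) * extensions S col xs x)%N%:R.

Let uS (G : sgraph) (S : {set G}) (col : G -> C) c xs x :
  u S col (c :: xs) x = ((x \in S) : nat)%:R *
    \sum_w (edge x w)%:R * (((col w == c) : nat)%:R * u S col xs w).
Proof.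
rewrite /u natrM; congr (_ * _); rewrite /= natr_sum [LHS]big_mkcond.
apply: eq_bigr => w _; rewrite -!natrM.
by case: (w \in S); case: edge; case: (col w == c);
  rewrite ?mul0r ?mul1r ?mul0n ?mul1n.
Qed.

(** The vector of the numbers of continuations is obtained from the all-ones
    vector by alternately applying the adjacency matrix and diagonal indicators
    of colour classes; M intertwines all of these, and maps the all-ones vector
    to row_sum times the all-ones vector. *)
Lemma mul_extensions xs x :
  \sum_y M x y * u S2 col2 xs y = row_sum * u S1 col1 xs x.
Proof.
have cS : compat (fun x => (x \in S1) : nat) (fun y => (y \in S2) : nat).
  by move=> a b /compatS /= ->.
elim: xs x => [|c xs IH] x.
  rewrite -(row_sumE x) mulr_suml; apply: eq_bigr => y _.
  by rewrite /u /= !muln1 -(compat_mul cS) mulrC.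
have cC : compat (fun x => (col1 x == c) : nat) (fun y => (col2 y == c) : nat).
  by move=> a b /compatC /= ->.
under eq_bigr do rewrite uS mulrA -(compat_mul cS) -mulrA.
rewrite -mulr_sumr uS mulrCA; congr (_ * _).
under eq_bigr do rewrite mulr_sumr.
rewrite exchange_big mulr_sumr /=.
transitivity (\sum_w \sum_x' (edge x x')%:R * M x' w *
    (((col2 w == c) : nat)%:R * u S2 col2 xs w)).
  apply: eq_bigr => w _; under eq_bigr do rewrite mulrA.
  by rewrite -!mulr_suml AM.
rewrite exchange_big; apply: eq_bigr => x' _ /=.
rewrite [RHS]mulrCA [row_sum * _]mulrCA -IH !mulr_sumr; apply: eq_bigr => w _.
by rewrite -!mulrA; congr (_ * _); rewrite !mulrA -(compat_mul cC).
Qed.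

(** Multiplying [mul_extensions] on the left by the all-ones row vector, for
    which M also acts as the scalar row_sum. *)
Lemma compat_walks c xs : colored_walks S1 col1 c xs = colored_walks S2 col2 c xs.
Proof.
have cC : compat (fun x => (col1 x == c) : nat) (fun y => (col2 y == c) : nat).
  by move=> a b /compatC /= ->.
have E (G : sgraph) (S : {set G}) (col : G -> C) :
  (colored_walks S col c xs)%:R = \sum_x ((col x == c) : nat)%:R * u S col xs x.
  rewrite natr_sum [LHS]big_mkcond; apply: eq_bigr => x _.
  rewrite /u -natrM; case: (x \in S); case: (col x == c);
    by rewrite ?mul0n ?mul1n ?mul0n.
apply/eqP; rewrite -(eqr_nat F) !E; apply/eqP/(mulfI row_sum_neq0).
rewrite !mulr_sumr.
transitivity (\sum_x \sum_y ((col1 x == c) : nat)%:R * (M x y * u S2 col2 xs y)).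
  by apply: eq_bigr => x _; rewrite mulrCA -mul_extensions mulr_sumr.
rewrite exchange_big; apply: eq_bigr => y _ /=.
under eq_bigr do rewrite mulrA (compat_mul cC) -mulrA.
by rewrite -mulr_suml col_sumE.
Qed.

End Walks.

Section Prune.
Variables (S1 : {set G1}) (S2 : {set G2}) (C : eqType).
Variables (col1 : G1 -> C) (col2 : G2 -> C).
Hypotheses (compatS : compat (mem S1) (mem S2)) (compatC : compat col1 col2).
Hypothesis compatD : forall x y, M x y != 0 -> x \in S1 -> sdeg S1 x = sdeg S2 y.

Lemma compat_leaves : compat (mem (leaves S1)) (mem (leaves S2)).
Proof.
move=> x y nz /=; have /= xy := compatS nz; rewrite !inE -xy.
by case xS: (x \in S1) => //=; rewrite (compatD nz xS).
Qed.

Lemma compat_prune : compat (mem (prune S1)) (mem (prune S2)).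
Proof.
move=> x y nz /=; have /= xy := compatS nz; have /= l := compat_leaves nz.
by rewrite !in_prune xy l.
Qed.

Definition leaf_count (G : sgraph) (S : {set G}) (col : G -> C) c x : nat :=
  \sum_(l in leaves S | col l == c) edge x l.

(** The matrix A E A, where E is the indicator of the leaves of colour c. *)
Let Q (G : sgraph) (S : {set G}) (col : G -> C) c x x' : F :=
  \sum_l (edge x l)%:R *
    (((l \in leaves S) && (col l == c) : nat)%:R * (edge l x')%:R).

(** A leaf has a single neighbour in S, so it contributes to no off-diagonal
    entry. *)
Let Q_diag (G : sgraph) (S : {set G}) (col : G -> C) c x x' :
  x \in S -> x' \in S -> Q S col c x x' = (x == x')%:R * (leaf_count S col c x)%:R.
Proof.
move=> xS x'S; rewrite natr_sum [in RHS]big_mkcond mulr_sumr; apply: eq_bigr => l _.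
case lL: (l \in leaves S); rewrite /= ?mul0r ?mulr0 //.
case: (col l == c); rewrite /= ?mul0r ?mulr0 // mul1r.
have [_ _ h] := stemP lL; rewrite (edge_sym x) !h //.
have [-> |ne] := eqVneq x (stem S l); last by rewrite mul0r mulr0.
by rewrite mul1r mulr1 eq_sym.
Qed.

Let Q_comm c x y :
  \sum_x' Q S1 col1 c x x' * M x' y = \sum_y' M x y' * Q S2 col2 c y' y.
Proof.
have cL : compat (fun x => (x \in leaves S1) && (col1 x == c) : nat)
                 (fun y => (y \in leaves S2) && (col2 y == c) : nat).
  by move=> a b nz; have /= -> := compat_leaves nz; rewrite (compatC nz).
transitivity (\sum_l \sum_m (edge x l)%:R * (M l m *
   ((((m \in leaves S2) && (col2 m == c) : nat))%:R * (edge m y)%:R))).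
  under eq_bigr do rewrite mulr_suml.
  rewrite exchange_big; apply: eq_bigr => l _ /=.
  under eq_bigr do rewrite -!mulrA.
  rewrite -!mulr_sumr AM mulr_sumr; congr (_ * _); apply: eq_bigr => m _.
  by rewrite mulrA (compat_mul cL) mulrA.
under [RHS]eq_bigr do rewrite mulr_sumr.
rewrite exchange_big [RHS]exchange_big; apply: eq_bigr => m _ /=.
under eq_bigr do rewrite mulrA.
rewrite -mulr_suml AM mulr_suml; apply: eq_bigr => y' _.
by rewrite -!mulrA.
Qed.

(** In [Q_comm] only terms with x', y' in the pruned sets survive, because M
    respects these sets; on them Q is diagonal, and M x y cancels. *)
Lemma compat_leaf_count c x y : M x y != 0 -> x \in prune S1 ->
  leaf_count S1 col1 c x = leaf_count S2 col2 c y.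
Proof.
move=> nz xR; have /= := compat_prune nz; rewrite xR => /esym yR.
have inS (G : sgraph) (S : {set G}) z : z \in prune S -> z \in S.
  by rewrite in_prune => /andP[].
have xS := inS _ _ _ xR; have yS := inS _ _ _ yR.
apply/eqP; rewrite -(eqr_nat F); apply/eqP/(mulIf nz).
transitivity (\sum_x' Q S1 col1 c x x' * M x' y).
  rewrite (bigD1 x) //= [X in _ + X]big1 ?addr0 => [|x' ne].
    by rewrite (Q_diag _ _ xS xS) eqxx mul1r.
  have [->|nz'] := eqVneq (M x' y) 0; first by rewrite mulr0.
  have /= := compat_prune nz'; rewrite yR => /inS x'S.
  by rewrite (Q_diag _ _ xS x'S) eq_sym (negbTE ne) !mul0r.
rewrite Q_comm (bigD1 y) //= [X in _ + X]big1 ?addr0 => [|y' ne].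
  by rewrite (Q_diag _ _ yS yS) eqxx mul1r mulrC.
have [->|nz'] := eqVneq (M x y') 0; first by rewrite mul0r.
have /= := compat_prune nz'; rewrite xR => /esym/inS y'S.
by rewrite (Q_diag _ _ y'S yS) (negbTE ne) mul0r mulr0.
Qed.

End Prune.
End Similar.

(** * Growing the leaves back and the theorem *)

Lemma labelled_bijection (T1 T2 : finType) (L : eqType) (A : {set T1})
    (B : {set T2}) (lab1 : T1 -> L) (lab2 : T2 -> L) (y0 : T2) :
  perm_eq [seq lab1 x | x <- enum A] [seq lab2 y | y <- enum B] ->
  exists g : T1 -> T2,
    [/\ {in A &, injective g}, g @: A = B & {in A, forall x, lab2 (g x) = lab1 x}].
Proof.
move=> hp; have /(perm_iotaP (lab2 y0))[Is pIs e] := hp.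
rewrite size_map in pIs.
have sAB : size (enum A) = size (enum B) by have := perm_size hp; rewrite !size_map.
have sIs : size Is = size (enum A) by rewrite (perm_size pIs) size_iota.
pose g x := nth y0 (enum B) (nth 0 Is (index x (enum A))).
have idx x : x \in A -> index x (enum A) < size Is.
  by move=> xA; rewrite sIs index_mem mem_enum.
have ltI x : x \in A -> nth 0 Is (index x (enum A)) < size (enum B).
  by move=> xA; have := mem_nth 0 (idx x xA); rewrite (perm_mem pIs) mem_iota.
have gI : {in A &, injective g}.
  move=> x y xA yA /eqP; rewrite nth_uniq ?ltI ?enum_uniq // nth_uniq ?idx //.
    by move=> /eqP e'; apply: (index_inj x _ _ e'); rewrite mem_enum.
  by rewrite (perm_uniq pIs) iota_uniq.
exists g; split=> //.
- apply/eqP; rewrite eqEcard card_in_imset // !cardE sAB leqnn andbT.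
  by apply/subsetP => y /imsetP[x xA ->]; rewrite -mem_enum mem_nth ?ltI.
- move=> x xA; have := congr1 (fun s => nth (lab2 y0) s (index x (enum A))) e.
  rewrite (nth_map x) -?sIs ?idx // nth_index ?mem_enum // => ->.
  by rewrite (nth_map 0) ?idx // (nth_map y0) ?ltI.
Qed.

Section LeafColors.
Variables (G : sgraph) (S : {set G}) (col : G -> nat).

(** Sorting turns the multiset of leaf colours into a canonical value. *)
Definition leaf_colors x := sort leq [seq col l | l <- enum (leaves S) & edge x l].

(** Colours are encoded as natural numbers, so that all pruning stages use the
    same type of colours.  The value 0 outside of the pruned set makes the
    function compatible with M on all vertices. *)
Definition prune_color x :=
  if x \in prune S then pickle (col x, leaf_colors x) else 0.

Lemma count_leaf_colors c x : count_mem c (leaf_colors x) = leaf_count S col c x.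
Proof.
rewrite count_sort count_map count_filter -sum1_count big_enum_cond /=.
rewrite /leaf_count big_mkcond [RHS]big_mkcond /=; apply: eq_bigr => l _.
by case: (l \in leaves S) => //=; case: (col l == c); case: edge.
Qed.

Lemma size_leaf_colors x : size (leaf_colors x) = sdeg (leaves S) x.
Proof.
rewrite size_sort size_map size_filter /sdeg cardsE -sum1_card.
rewrite -sum1_count big_enum_cond /=.
by apply: eq_bigl => l; rewrite [in RHS]unfold_in.
Qed.

End LeafColors.

Section Extension.
Variables (G1 G2 : sgraph) (S1 : {set G1}) (S2 : {set G2}).
Variables (col1 : G1 -> nat) (col2 : G2 -> nat).
Hypotheses (cyc1 : one_cycle S1) (cyc2 : one_cycle S2).

(** A leaf is described by its stem and its colour.  Transporting stems by f,
    each description occurs equally often in the two graphs, since it occurs as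
    often as its colour among the leaf colours of the stem. *)
Lemma iso_extend f :
  iso_on (prune S1) (prune S2) (prune_color S1 col1) (prune_color S2 col2) f ->
  exists f', iso_on S1 S2 col1 col2 f'.
Proof.
case=> fI fS fE fC.
have fP x : x \in prune S1 -> f x \in prune S2 by move=> xR; rewrite -fS imset_f.
have pcol x : x \in prune S1 -> col2 (f x) = col1 x /\
    leaf_colors S2 col2 (f x) = leaf_colors S1 col1 x.
  move=> xR; have := fC x xR; rewrite /prune_color xR fP //.
  by move=> /(pcan_inj pickleK)[].
have [z zR] : exists z, z \in prune S1.
  by have [/set0Pn] := one_cycle_prune cyc1.
pose lab1 l := (f (stem S1 l), col1 l); pose lab2 l := (stem S2 l, col2 l).
have [g [gI gS gL]] : exists g : G1 -> G2, [/\ {in leaves S1 &, injective g},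
    g @: leaves S1 = leaves S2 & {in leaves S1, forall x, lab2 (g x) = lab1 x}].
  apply: labelled_bijection (f z) _.
  apply/allP => -[y c] _; apply/eqP; rewrite !count_map -!sum1_count.
  rewrite !big_enum_cond /=.
  have [yR|yR] := boolP (y \in prune S2); last first.
    rewrite !big_pred0 // => l; apply/negP => /andP[lL] /eqP[e _]; case/negP: yR.
      by rewrite -e stem_prune.
    by rewrite -e; apply/fP/stem_prune.
  move: yR; rewrite -fS => /imsetP[x xR ->].
  have := congr1 (count_mem c) (pcol x xR).2; rewrite !count_leaf_colors => /esym.
  have xS : x \in S1 by move: xR; rewrite in_prune => /andP[].
  have fxS : f x \in S2 by move: (fP _ xR); rewrite in_prune => /andP[].
  rewrite /leaf_count big_mkcondr [in X in _ = X -> _]big_mkcondr.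
  move=> e; rewrite !big_mkcondr.
  transitivity (\sum_(l in leaves S1) if col1 l == c then edge x l : nat else 0).
    apply: eq_bigr => l lL; rewrite xpair_eqE andbC; case: (col1 l == c) => //=.
    have [_ _ h] := stemP lL; rewrite edge_sym h // eq_sym.
    by rewrite (inj_in_eq fI) ?stem_prune //; case: eqP.
  rewrite e; apply: eq_bigr => l lL; rewrite xpair_eqE andbC.
  case: (col2 l == c) => //=; have [_ _ h] := stemP lL.
  by rewrite edge_sym h // eq_sym; case: eqP.
have gP l : l \in leaves S1 -> [/\ g l \in leaves S2, stem S2 (g l) = f (stem S1 l) &
    col2 (g l) = col1 l].
  by move=> lL; have [-> ->] := gL l lL; rewrite -gS imset_f.
pose h x := if x \in leaves S1 then g x else f x.
have inR x : x \in S1 -> x \notin leaves S1 -> x \in prune S1.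
  by move=> xS xL; rewrite in_prune xL.
have RL x : x \in prune S2 -> x \notin leaves S2 by rewrite in_prune => /andP[].
have LS x : x \in leaves S2 -> x \in S2 by apply/subsetP/leavesS.
have RS x : x \in prune S2 -> x \in S2 by rewrite in_prune => /andP[].
have edge_fg x l : x \in prune S1 -> l \in leaves S1 -> edge (f x) (g l) = edge x l.
  move=> xR lL; have [gL2 sg _] := gP l lL.
  have [_ _ h1] := stemP lL; have [_ _ h2] := stemP gL2.
  rewrite !(edge_sym _ l) edge_sym h2 ?RS ?fP // h1;
    last by move: xR; rewrite in_prune => /andP[].
  by rewrite sg (inj_in_eq fI) ?stem_prune.
have leaf_leaf (G : sgraph) (S : {set G}) l m : one_cycle S -> l \in leaves S ->
    m \in leaves S -> edge l m = false.
  move=> cS lL mL; have [_ _ hl] := stemP lL.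
  rewrite hl ?(subsetP (leavesS S)) //; apply/eqP => e.
  by have := stem_prune cS lL; rewrite -e in_prune mL.
have hI : {in S1 &, injective h}.
  move=> x y xS yS; rewrite /h.
  case: (boolP (x \in leaves S1)) => xL; case: (boolP (y \in leaves S1)) => yL.
  - exact: gI.
  - move=> e; have := RL _ (fP y (inR _ yS yL)); rewrite -e.
    by have [-> _ _] := gP x xL.
  - move=> e; have := RL _ (fP x (inR _ xS xL)); rewrite e.
    by have [-> _ _] := gP y yL.
  - by apply: fI; apply: inR.
exists h; split=> //.
- apply/setP => y; apply/imsetP/idP => [[x xS ->]|yS]; rewrite /h.
    case: (boolP (x \in leaves S1)) => xL; first by have [/LS] := gP x xL.
    by apply/RS/fP/inR.
  case: (boolP (y \in leaves S2)) => yL.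
    move: yL; rewrite -gS => /imsetP[x xL ->]; exists x; last by rewrite xL.
    exact: subsetP (leavesS S1) _ xL.
  have : y \in prune S2 by rewrite in_prune yL.
  rewrite -fS => /imsetP[x xR ->]; move: xR; rewrite in_prune => /andP[xL xS].
  by exists x; rewrite // (negbTE xL).
- move=> x y xS yS; rewrite /h.
  case: (boolP (x \in leaves S1)) => xL; case: (boolP (y \in leaves S1)) => yL.
  - have [gx _ _] := gP x xL; have [gy _ _] := gP y yL.
    by rewrite (leaf_leaf _ _ _ _ cyc1 xL yL) (leaf_leaf _ _ _ _ cyc2 gx gy).
  - by rewrite edge_sym edge_fg ?inR // edge_sym.
  - by rewrite edge_fg ?inR.
  - by apply: fE; apply: inR.
- move=> x xS; rewrite /h; case: (boolP (x \in leaves S1)) => xL.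
    by have [] := gP x xL.
  by have [] := pcol x (inR _ xS xL).
Qed.

End Extension.

Section Reconstruction.
Variables (F : numClosedFieldType) (G1 G2 : sgraph).
Variables (M : G1 -> G2 -> F) (N : G2 -> G1 -> F).
Local Open Scope ring_scope.
Hypothesis MN : forall x x', \sum_y M x y * N y x' = (x == x')%:R.
Hypothesis NM : forall y y', \sum_x N y x * M x y' = (y == y')%:R.
Hypothesis AM : forall x y,
  \sum_x' (edge x x')%:R * M x' y = \sum_y' M x y' * (edge y' y)%:R.
Hypothesis degM : compat M (@deg G1) (@deg G2).
Hypothesis conn1 : connected_in [set: G1].
Variable x0 : G1.
Local Close Scope ring_scope.

(** Induction on the number of remaining vertices.  The degree condition is
    restored after pruning because the number of deleted neighbours is the size
    of the multiset of leaf colours. *)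
Lemma colored_iso n (S1 : {set G1}) (S2 : {set G2}) (col1 : G1 -> nat)
    (col2 : G2 -> nat) :
  #|S1| < n ->
  one_cycle S1 -> one_cycle S2 ->
  compat M (mem S1) (mem S2) -> compat M col1 col2 ->
  (forall x y, M x y != 0%R -> x \in S1 -> sdeg S1 x = sdeg S2 y) ->
  exists f, iso_on S1 S2 col1 col2 f.
Proof.
elim: n S1 S2 col1 col2 => // n IH S1 S2 col1 col2 ltS cyc1 cyc2 hS hC hD.
have hL := compat_leaves hS hD; have hR := compat_prune hS hD.
have cardL := compat_card MN NM hL.
have [L1|L1] := eqVneq (leaves S1) set0.
  have L2 : leaves S2 = set0 by apply: cards0_eq; rewrite -cardL L1 cards0.
  have [S1n c1 _] := cyc1; have [_ c2 _] := cyc2.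
  apply: cycle_iso => //; try exact: no_leaf_sdeg.
    exact: (compat_card MN NM hS).
  by move=> c xs; apply: compat_walks.
have hlc x y : M x y != 0%R -> x \in prune S1 ->
    leaf_colors S1 col1 x = leaf_colors S2 col2 y.
  move=> nz xR; apply: (sorted_eq leq_trans anti_leq); rewrite ?sort_sorted //;
    try exact: leq_total.
  apply/allP => c _; apply/eqP; rewrite !count_leaf_colors.
  exact: (compat_leaf_count AM hS hC hD c nz xR).
have [f hf] : exists f, iso_on (prune S1) (prune S2)
    (prune_color S1 col1) (prune_color S2 col2) f.
  apply: IH => //.
  - rewrite ltnS in ltS; apply: leq_trans ltS; apply: proper_card.
    have [l lL] := set0Pn _ L1; apply/properP; split; first exact: subsetDl.
    by exists l; [apply: subsetP (leavesS S1) _ lL | rewrite in_prune lL].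
  - exact: one_cycle_prune.
  - exact: one_cycle_prune.
  - move=> x y nz; have /= xy := hR x y nz; rewrite /prune_color -xy.
    by case: ifP => // xR; rewrite (hC _ _ nz) (hlc _ _ nz xR).
  - move=> x y nz xR; have xS : x \in S1 by move: xR; rewrite in_prune => /andP[].
    have := hD x y nz xS; rewrite (sdeg_prune S1) (sdeg_prune S2).
    rewrite -!(size_leaf_colors _ col1) -!(size_leaf_colors _ col2).
    by rewrite (hlc _ _ nz xR) => /addIn.
exact: iso_extend hf.
Qed.

(** The second graph inherits connectedness from the Laplacian kernel and the
    degree sum from the equality of traces; the colouring starts out constant. *)
Lemma similar_iso : one_cycle [set: G1] -> isomorphic G1 G2.
Proof.
move=> cyc1.
have degT (G : sgraph) (x : G) : sdeg [set: G] x = deg x.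
  by apply: eq_card => y; rewrite !inE.
have cyc2 : one_cycle [set: G2].
  have hT : compat M (mem [set: G1]) (mem [set: G2]) by move=> x y _; rewrite /= !inE.
  have cT := compat_card MN NM hT.
  split.
  - by rewrite -card_gt0 -cT; apply/card_gt0P; exists x0.
  - exact: (conn_transfer MN NM AM degM conn1 x0).
  - have [_ _ s1] := cyc1; rewrite -cT -s1.
    rewrite big_mkcond [RHS]big_mkcond; apply/esym.
    apply: (compat_sum MN NM) => x y nz /=.
    by rewrite !inE !degT; apply: degM.
have [f [fI fS fE _]] : exists f, iso_on [set: G1] [set: G2] (fun=> 0) (fun=> 0) f.
  apply: (@colored_iso #|[set: G1]|.+1) => //.
  - by move=> x y _; rewrite /= !inE.
  - by move=> x y nz _; rewrite !degT; apply: degM.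
exists f; split; last by move=> x y; apply: fE; rewrite inE.
apply: inj_card_bij; first by move=> x y; apply: fI; rewrite inE.
by rewrite -!cardsT -fS leq_imset_card.
Qed.

End Reconstruction.

Local Open Scope ring_scope.
Theorem theorem1p2 (R : realType) (G1 G2 : sgraph) :
  degree_similar R G1 G2 -> unicyclic G1 -> isomorphic G1 G2.
Proof.
case=> M [[N [MN NM]] AM DM] uG1.
have cyc1 := unicyclic_one_cycle uG1.
have [n0 conn1 _] := cyc1; have [x0 _] := set0Pn _ n0.
have sum_rank (G : sgraph) (h : 'I_#|G| -> R[i]) :
    \sum_(x : G) h (enum_rank x) = \sum_i h i.
  by rewrite [RHS](reindex enum_rank) //; apply/onW_bij/enum_rank_bij.
apply: (@similar_iso _ _ _ (fun x y => M (enum_rank x) (enum_rank y))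
  (fun y x => N (enum_rank y) (enum_rank x)) _ _ _ _ conn1 x0 cyc1).
- move=> x x'.
  rewrite (sum_rank _ (fun j => M (enum_rank x) j * N j (enum_rank x'))).
  by have /matrixP/(_ (enum_rank x) (enum_rank x')) := MN;
    rewrite !mxE (inj_eq enum_rank_inj).
- move=> y y'.
  rewrite (sum_rank _ (fun j => N (enum_rank y) j * M j (enum_rank y'))).
  by have /matrixP/(_ (enum_rank y) (enum_rank y')) := NM;
    rewrite !mxE (inj_eq enum_rank_inj).
- move=> x y; have /matrixP/(_ (enum_rank x) (enum_rank y)) := AM.
  rewrite !mxE => e.
  rewrite (eq_bigr (fun x' => adj_mx R[i] G1 (enum_rank x) (enum_rank x') *
    M (enum_rank x') (enum_rank y))) => [|x' _]; last by rewrite mxE !enum_rankK.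
  rewrite (sum_rank _ (fun i => adj_mx R[i] G1 (enum_rank x) i * M i (enum_rank y))).
  rewrite e -sum_rank; apply: eq_bigr => y' _.
  by rewrite mxE !enum_rankK.
- move=> x y nz; have /matrixP/(_ (enum_rank x) (enum_rank y)) := DM.
  rewrite mul_diag_mx mul_mx_diag !mxE !enum_rankK mulrC => /(mulfI nz)/eqP.
  by rewrite eqr_nat => /eqP.
Qed.
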